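(* Fix $0<C_\tau<\infty$. Assume that $c_\beta n\le\beta_n\le C_\beta n$ for constants $0<c_\beta\le C_\beta<\infty$, that $K$ is fixed or belongs to a fixed finite set of integers $\ge2$, and that all constants below are positive, finite and uniform in $n$ and $\theta\in\mathcal{O}_n$. Let $M=KB$ and $\tau_M^2(\theta)=\beta_n^2\operatorname{Var}_\xi\{\bar\ell_M(\theta,\xi)\}$. 1. If MC-blocks satisfy $$c_\ell M^{-1}\le\operatorname{Var}\{\bar\ell_M(\theta,\xi)\}\le C_\ell M^{-1},$$ then the uniform bound $\sup_{\theta\in\mathcal{O}_n}\tau_M^2(\theta)\le C_\tau$ requires $M\ge c_0n^2$ (for some constant $c_0>0$ not depending on $n$) and is achieved by $M=C_0n^2$ for sufficiently large $C_0$. 2. Suppose that, for the chosen $d$-dimensional RQMC representation and some constants $C<\infty$ and $\alpha>0$, the block estimator variance satisfies $$\operatorname{Var}\{\widehat\ell_B^{(k)}(\theta,\xi_k)\}\le C B^{-\alpha}\{\log(2+B)\}^{d-1}.$$ Then, for sufficiently large $C_0$, $$M_n=C_0\,n^{2/\alpha}\{\log(2+n)\}^{(d-1)/\alpha}$$ satisfies the same uniform bound $\sup_{\theta\in\mathcal{O}_n}\tau_{M_n}^2(\theta)\le C_\tau$. Equivalently, a sufficient RQMC budget has order $\widetilde O(n^{2/\alpha})$, where $\widetilde O$ suppresses logarithmic factors.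
   Context: For each $n$, $\mathcal{O}_n$ is a (nonempty) region of the parameter space and $\ell(\theta)=\int L(\theta,x)P(dx)$ is a loss (possibly depending on $n$). For block size $B$ and block count $K$, the random blocks $\xi_k=(\xi_{k,1},\dots,\xi_{k,B})$, $k=1,\dots,K$, are independent and identically distributed, the block estimate is $\widehat\ell_B^{(k)}(\theta,\xi_k)=B^{-1}\sum_{b=1}^BL(\theta,\xi_{k,b})$ with $\mathbb{E}\,\widehat\ell_B^{(k)}(\theta,\xi_k)=\ell(\theta)$, and $\bar\ell_M(\theta,\xi)=K^{-1}\sum_{k=1}^K\widehat\ell_B^{(k)}(\theta,\xi_k)$, where $\xi=(\xi_1,\dots,\xi_K)$ and $M=KB$ is the per-proposal budget. MC-blocks: the $\xi_{k,b}$ are i.i.d. from $P$. RQMC blocks: the points within a block are $d$-dimensional ($d\ge1$ fixed) randomized quasi-Monte Carlo points, possibly dependent within a block, with independent randomizations across blocks. Budgets such as $C_0n^2$ are understood to be rounded up to an integer multiple of $K$. *)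

(* Defs.v *)
From HB Require Import structures.
From mathcomp Require Import all_boot all_order all_algebra.
From mathcomp Require Import all_classical all_reals all_analysis.
Set Implicit Arguments.
Unset Strict Implicit.
Unset Printing Implicit Defensive.
Import Order.TTheory GRing.Theory Num.Theory.
Import numFieldNormedType.Exports.
Local Open Scope classical_set_scope.
Local Open Scope ring_scope.

Definition mutually_independent {d d' : measure_display}
    {Omega : measurableType d} {T : measurableType d'} {R : realType}
    (Pr : probability Omega R) (I : finType) (X : I -> Omega -> T) : Prop :=
  forall (J : {set I}) (A : I -> set T),
    (forall i, i \in J -> measurable (A i)) ->
    (Pr (\bigcap_(i in [set` J]) (X i @^-1` A i)) =
     \prod_(i in J) Pr (X i @^-1` A i))%E.

Definition has_law {d d' : measure_display}
    {Omega : measurableType d} {T : measurableType d'} {R : realType}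
    (Pr : probability Omega R) (X : Omega -> T) (mu : set T -> \bar R) : Prop :=
  forall A : set T, measurable A -> Pr (X @^-1` A) = mu A.

Definition iid {d d' : measure_display}
    {Omega : measurableType d} {T : measurableType d'} {R : realType}
    (Pr : probability Omega R) (I : finType) (X : I -> Omega -> T) : Prop :=
  [/\ forall i, measurable_fun [set: Omega] (X i),
      mutually_independent Pr X
    & forall i j, has_law Pr (X i) (fun A => Pr (X j @^-1` A))].

Definition uniform_on_cube {d : measure_display} {Omega : measurableType d}
    {R : realType} (Pr : probability Omega R) (s : nat)
    (U : Omega -> s.-tuple R) : Prop :=
  let coord (j : 'I_s) (w : Omega) : R := tnth (U w) j in
  iid Pr coord /\ forall j, has_law Pr (coord j) (uniform_prob (@ltr01 R)).

Definition block_estimate {T : Type} {R : realType} (f : T -> R) (B : nat)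
    (x : B.-tuple T) : R :=
  B%:R^-1 * \sum_(b < B) f (tnth x b).

Definition averaged_estimate {Omega T : Type} {R : realType} (f : T -> R)
    (K B : nat) (xi : 'I_K -> Omega -> B.-tuple T) (w : Omega) : R :=
  K%:R^-1 * \sum_(k < K) block_estimate f (xi k w).

Definition unbiased_blocks {d d' : measure_display} {Omega : measurableType d}
    {T : measurableType d'} {R : realType} (Pr : probability Omega R)
    (P : probability T R) (f : T -> R) (K B : nat)
    (xi : 'I_K -> Omega -> B.-tuple T) : Prop :=
  forall k, ('E_Pr[fun w => block_estimate f (xi k w)] =
             (\int[P]_x f x)%R%:E)%E.

Definition mc_blocks {d d' : measure_display} {Omega : measurableType d}
    {T : measurableType d'} {R : realType} (Pr : probability Omega R)
    (P : probability T R) (K B : nat)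
    (xi : 'I_K -> Omega -> B.-tuple T) : Prop :=
  let point (kb : 'I_K * 'I_B) (w : Omega) := tnth (xi kb.1 w) kb.2 in
  iid Pr point /\ forall kb, has_law Pr (point kb) P.

(* The dependence between the points of one block is unrestricted: how evenly
   they fill the cube is only quantified by a variance bound, assumed
   separately. *)
Definition rqmc_blocks {d : measure_display} {Omega : measurableType d}
    {R : realType} (Pr : probability Omega R) (s K B : nat)
    (u : 'I_K -> Omega -> B.-tuple (s.-tuple R)) : Prop :=
  iid Pr u /\ forall k b, uniform_on_cube Pr (fun w => tnth (u k w) b).

Definition tau2 {d : measure_display} {Omega : measurableType d} {T : Type}
    {R : realType} (Pr : probability Omega R) (beta : R) (f : T -> R)
    (K B : nat) (xi : 'I_K -> Omega -> B.-tuple T) : \bar R :=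
  ((beta ^+ 2)%:E * 'V_Pr[averaged_estimate f xi])%E.

(* K * block_size K x is the least multiple of K that is at least x (x >= 0). *)
Definition block_size {R : realType} (K : nat) (x : R) : nat :=
  `|Num.ceil (x / K%:R)|%N.

Definition mc_budget {R : realType} (C0 : R) (n : nat) : R := C0 * n%:R ^+ 2.

Definition rqmc_budget {R : realType} (alpha : R) (s : nat) (C0 : R)
    (n : nat) : R :=
  C0 * n%:R `^ (2 / alpha) * ln (2 + n%:R) `^ (s.-1%:R / alpha).

Definition soft_bigO {R : realType} (f g : nat -> R) : Prop :=
  exists p : nat, f =O_\oo (fun n => g n * ln (2 + n%:R) ^+ p).

(* Main.v *)
Require Import Defs.
From HB Require Import structures.
From mathcomp Require Import all_boot all_order all_algebra.
From mathcomp Require Import all_classical all_reals all_analysis.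
From mathcomp Require Import measurable_realfun ring lra.
Set Implicit Arguments.
Unset Strict Implicit.
Unset Printing Implicit Defensive.
Import Order.TTheory GRing.Theory Num.Theory.
Import numFieldNormedType.Exports.
Local Open Scope classical_set_scope.
Local Open Scope ring_scope.

(* For i.i.d. blocks the assumed two-sided bound on the variance turns the
   uniform bound into an inequality between n ^ 2 and M.  For randomized
   quasi-Monte Carlo blocks, convexity of the square bounds the variance of the
   average by the common bound C * B ^ (- alpha) * ln (2 + B) ^ (d - 1) on the
   variances of the blocks; since K is bounded, this costs only a constant
   factor.  It remains to see that the logarithm ln (2 + B) grows like ln n, so
   that the logarithmic factor in the budget absorbs it. *)

(** * Variance of an average of blocks *)

Lemma sqr_mean_le (R : realFieldType) (K : nat) (a : 'I_K -> R) :
  (K%:R^-1 * \sum_k a k) ^+ 2 <= K%:R^-1 * \sum_k a k ^+ 2.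
Proof.
have [K0|K0] := eqVneq K 0%N.
  by subst K; rewrite !big_ord0 !mulr0 expr0n.
have KR : K%:R != 0 :> R by rewrite pnatr_eq0.
set m := K%:R^-1 * \sum_k a k.
have sumE : \sum_k a k = K%:R * m by rewrite mulrA mulfV// mul1r.
(* Expanding around the mean, this sum is [K] times the gap between the two sides of the claim. *)
have : 0 <= \sum_k (a k - m) ^+ 2 by apply: sumr_ge0 => k _; exact: sqr_ge0.
have -> : \sum_k (a k - m) ^+ 2 = \sum_k a k ^+ 2 - K%:R * m ^+ 2.
  under eq_bigr do rewrite sqrrB.
  rewrite big_split/= sumrB sumr_const card_ord -[m ^+ 2 *+ K]mulr_natl.
  rewrite sumrMnl -mulr_suml sumE; ring.
by rewrite subr_ge0 ler_pdivlMl// lt_def KR ler0n.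
Qed.

(** The integral is the difference of the integrals of the positive and negative parts. As
    [+oo - +oo] is [-oo] by convention, such a difference is finite only when both terms are. *)
Lemma integrable_finite_integral d (T : measurableType d) (R : realType)
    (mu : {measure set T -> \bar R}) (f : T -> \bar R) :
  measurable_fun [set: T] f -> (\int[mu]_x f x)%E \is a fin_num ->
  mu.-integrable [set: T] f.
Proof.
move=> mf; rewrite integralE => ffin; apply/integrableP; split=> //.
rewrite (_ : (fun x => `|f x|)%E = (f^\+ \+ f^\-)%E); last first.
  exact: fune_abse.
rewrite ge0_integralD//; last 2 first.
- exact: measurable_funepos.
- exact: measurable_funeneg.
have p0 : (0 <= \int[mu]_x f^\+ x)%E by exact: integral_ge0.
have n0 : (0 <= \int[mu]_x f^\- x)%E by exact: integral_ge0.
move: (\int[mu]_x f^\+ x)%E (\int[mu]_x f^\- x)%E ffin p0 n0.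
by move=> [r| |] [s| |] //=; rewrite ltry.
Qed.

(** [sqr_mean_le] is applied pointwise to the centred variables [Y k - m k] and then integrated; the
    integrands are nonnegative, so this makes sense in the extended reals. Finite expectations
    ensure that the mean of the average is the average of the means. *)
Lemma variance_mean_le d (T : measurableType d) (R : realType)
    (Pr : probability T R) (K : nat) (Y : 'I_K -> T -> R) (v : R) :
  (0 < K)%N -> (forall k, measurable_fun [set: T] (Y k)) ->
  (forall k, 'E_Pr[Y k] \is a fin_num)%E ->
  (forall k, 'V_Pr[Y k] <= v%:E)%E ->
  ('V_Pr[fun w => (K%:R^-1 * \sum_k Y k w)%R] <= v%:E)%E.
Proof.
move=> K0 mY finE VY.
have KR : (0 < K%:R :> R) by rewrite ltr0n.
pose m k := fine ('E_Pr[Y k])%E.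
have iY k : Pr.-integrable [set: T] (EFin \o Y k).
  apply: integrable_finite_integral; first exact/measurable_EFinP.
  by have := finE k; rewrite unlock.
have EY k : (\int[Pr]_w (Y k w)%:E)%E = (m k)%:E.
  by rewrite /m fineK; [rewrite unlock|exact: finE].
have EM : ('E_Pr[fun w => (K%:R^-1 * \sum_k Y k w)%R] =
    (K%:R^-1 * \sum_k m k)%:E)%E.
  rewrite unlock.
  under eq_integral do rewrite EFinM -sumEFin.
  rewrite integralZl//; last by apply: integrable_sum => // k _; exact: iY.
  rewrite integral_sum// EFinM -sumEFin; congr (_ * _)%E.
  by apply: eq_bigr => k _; exact: EY.
have VE (Z : T -> R) : ('V_Pr[Z] =
    \int[Pr]_w ((Z w - fine 'E_Pr[Z]) ^+ 2)%:E)%E.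
  by rewrite /variance !unlock.
have mS k : measurable_fun [set: T] (fun w => ((Y k w - m k) ^+ 2)%:E).
  apply/measurable_EFinP; apply: measurable_funX; exact: measurable_funB.
rewrite VE EM/=.
apply: (@le_trans _ _ (\int[Pr]_w (K%:R^-1%:E * \sum_(k < K)
    ((Y k w - m k) ^+ 2)%:E))%E).
  apply: ge0_le_integral => //.
  - by move=> w _; rewrite lee_fin sqr_ge0.
  - apply/measurable_EFinP; apply: measurable_funX; apply: measurable_funB => //.
    by apply: measurable_funM => //; exact: measurable_sum.
  - by apply: measurable_funeM; exact: emeasurable_sum.
  - move=> w _; rewrite sumEFin -EFinM lee_fin -mulrBr -sumrB.
    exact: sqr_mean_le.
rewrite ge0_integralZl//; last 2 first.
- exact: emeasurable_sum.
- by move=> w _; apply: sume_ge0 => k _; rewrite lee_fin sqr_ge0.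
rewrite ge0_integral_sum//; last by move=> k w _; rewrite lee_fin sqr_ge0.
apply: (@le_trans _ _ (K%:R^-1%:E * \sum_(k < K) v%:E)%E).
  rewrite lee_pmul2l// ?lte_fin ?invr_gt0//.
  by apply: lee_sum => k _; rewrite -VE.
rewrite sumEFin -EFinM lee_fin sumr_const card_ord -[v *+ K]mulr_natl.
by rewrite mulrA mulVf ?mul1r// gt_eqF.
Qed.

(** * Rounding of budgets and growth of logarithms *)

Lemma block_size_bounds (R : realType) (K : nat) (x : R) :
  (0 < K)%N -> 0 < x ->
  [/\ (0 < block_size K x)%N, x <= (K * block_size K x)%:R,
      x / K%:R <= (block_size K x)%:R & (block_size K x)%:R < x / K%:R + 1].
Proof.
move=> K0 x0; have KR : 0 < K%:R :> R by rewrite ltr0n.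
have y0 : 0 < x / K%:R by rewrite divr_gt0.
have c0 : 0 < Num.ceil (x / K%:R) by rewrite ceil_gt0.
have sE : (block_size K x)%:R = (Num.ceil (x / K%:R))%:~R :> R.
  by rewrite /block_size natr_absz gtr0_norm.
have lo : x / K%:R <= (block_size K x)%:R by rewrite sE ceil_ge.
split=> //; first by rewrite /block_size absz_gt0 gt_eqF.
  by rewrite natrM mulrC -ler_pdivrMr.
by rewrite sE -ltrBlDr; have := ceilB1_lt (x / K%:R); rewrite rmorphB.
Qed.

(** A logarithm is at most y^e / e for every e > 0. With [e] small, its [p]-th power costs at most
    y^(alpha/2), and the remaining y^(alpha/2) absorbs all constants, collected in [A]. *)
Lemma polylog_le_powR (R : realType) (alpha c q D : R) (p : nat) :
  0 < alpha -> 0 <= c -> 0 <= q -> 0 <= D ->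
  exists2 Y : R, 1 <= Y &
    forall y, Y <= y -> D * (c * ln y + q) ^+ p <= y `^ alpha.
Proof.
move=> a0 c0 q0 D0.
(* Using [p.+1] keeps [e] meaningful at [p = 0] and still gives [e * p <= alpha / 2]. *)
pose e := alpha / (2 * p.+1%:R); have e0 : 0 < e by rewrite divr_gt0 ?mulr_gt0.
pose A := D * (c / e + q) ^+ p.
have A0 : 0 <= A by rewrite mulr_ge0// exprn_ge0// addr_ge0// divr_ge0// ltW.
(* The second term of the maximum is the point where y^(alpha/2) reaches [A]. *)
exists (Num.max 1 (A `^ (2 / alpha))); first by rewrite le_max lexx.
move=> y; rewrite ge_max => /andP[y1 yA].
have y0 : 0 < y by rewrite (lt_le_trans _ y1).
have ye1 : 1 <= y `^ e by rewrite -(powRr0 y) ler_powR// ltW.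
have lny : ln y <= y `^ e / e.
  by rewrite ler_pdivlMr// mulrC -ln_powR ltW// ln_sublinear// powR_gt0.
apply: (@le_trans _ _ (A * (y `^ e) ^+ p)).
  rewrite -mulrA ler_wpM2l// -exprMn lerXn2r ?nnegrE//.
  - by rewrite addr_ge0// mulr_ge0// ln_ge0.
  - by rewrite mulr_ge0 ?powR_ge0// addr_ge0// divr_ge0// ltW.
  - by rewrite mulrDl lerD// ?ler_peMr// -mulrA ler_wpM2l// mulrC.
have Ay : A <= y `^ (alpha / 2).
  have -> : A = (A `^ (2 / alpha)) `^ (alpha / 2).
    by rewrite -powRrM (_ : _ * _ = 1) ?powRr1//; field; rewrite gt_eqF.
  by rewrite ge0_ler_powR ?nnegrE ?powR_ge0// ?divr_ge0 ?(ltW a0) ?(ltW y0).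
have -> : y `^ alpha = y `^ (alpha / 2) * y `^ (alpha / 2).
  by rewrite -powRD -?splitr// gt_eqF ?implybT.
rewrite ler_pM ?exprn_ge0 ?powR_ge0// -powR_mulrn ?powR_ge0// -powRrM.
rewrite ler_powR// /e -mulrA ler_pM2l// invfM -mulrA ler_piMr ?invr_ge0//.
by rewrite ler_pdivrMl// mulr1 ler_nat.
Qed.

Lemma rqmc_budget_gt0 (R : realType) (alpha : R) (d : nat) (C0 : R) (n : nat) :
  0 < C0 -> (0 < n)%N -> 0 < rqmc_budget alpha d C0 n.
Proof.
move=> C00 n0; rewrite /rqmc_budget !mulr_gt0 ?powR_gt0 ?ltr0n// ln_gt0//.
by rewrite ltr_pwDl// ler1n.
Qed.

(* The budget [x] satisfies [x ^ alpha = C0 ^ alpha * n ^ 2 * l ^ (d - 1)] with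
   [l = ln (2 + n)], while [ln (2 + B)] is at most [l] times an affine function
   of [ln C0]; so [C0 ^ alpha] only has to beat a power of [ln C0]. *)
Lemma rqmc_budget_rate (R : realType) (alpha D : R) (d Kmax : nat) :
  0 < alpha -> 0 <= D ->
  exists2 C1 : R, 0 < C1 &
    forall C0, C1 <= C0 -> forall n K, (0 < n)%N -> (0 < K <= Kmax)%N ->
      let x := rqmc_budget alpha d C0 n in
      let B := block_size K x in
      [/\ K%:R <= x, (0 < B)%N &
          D * n%:R ^+ 2 * ln (2 + B%:R) ^+ d.-1 <= B%:R `^ alpha].
Proof.
move=> a0 D0; set p := d.-1.
pose a : R := ln 2; have a_gt0 : 0 < a by rewrite ln_gt0// ltr1n.
have q0 : 0 <= (2 + p%:R) / alpha by rewrite divr_ge0 ?addr_ge0 ?(ltW a0).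
have ia0 : 0 <= a^-1 by rewrite invr_ge0 ltW.
(* The power of [Kmax] pays for the division of the budget into [K] blocks, the power of 4 for
   applying the polylogarithmic bound at [4 * C0] instead of [C0]. *)
have D'0 : 0 <= D * Kmax%:R `^ alpha * 4 `^ alpha.
  by rewrite !mulr_ge0 ?powR_ge0.
have [Y Y1 HY] := polylog_le_powR p a0 ia0 q0 D'0.
pose a' := a `^ (p%:R / alpha); have a'0 : 0 < a' by rewrite powR_gt0.
(* The first term gives access to [HY]; the second makes the budget at least [Kmax], because its
   logarithmic factor is at least [a']. *)
exists (Num.max Y (Kmax%:R / a')); first by rewrite lt_max (lt_le_trans _ Y1).
move=> C0; rewrite ge_max => /andP[C0Y C0K] n K n0 /andP[K0 KK] x B.
have C01 : 1 <= C0 by rewrite (le_trans Y1).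
have C00 : 0 < C0 by rewrite (lt_le_trans _ C01).
have nR : 1 <= n%:R :> R by rewrite ler1n.
have nR0 : 0 < n%:R :> R by rewrite ltr0n.
have KR : 0 < K%:R :> R by rewrite ltr0n.
set l : R := ln (2 + n%:R).
have al : a <= l by rewrite /a /l ler_ln ?posrE ?addr_gt0// lerDl.
have l0 : 0 < l by rewrite (lt_le_trans a_gt0).
have n1 : 1 <= n%:R `^ (2 / alpha) :> R.
  by rewrite -[leLHS](powRr0 n%:R) ler_powR// divr_ge0 ?(ltW a0).
have x0 : 0 < x by exact: rqmc_budget_gt0.
have xK : K%:R <= x.
  rewrite (@le_trans _ _ Kmax%:R) ?ler_nat//.
  rewrite -[leLHS](@divfK _ a') ?gt_eqF// /x /rqmc_budget ler_pM//.
  - by rewrite divr_ge0 ?(ltW a'0).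
  - exact: ltW.
  - by rewrite (le_trans C0K)// ler_peMr// ltW.
  - by rewrite ge0_ler_powR ?nnegrE// ?divr_ge0 ?(ltW a0) ?(ltW a_gt0) ?(ltW l0).
have [B0 _ bB Bb] := block_size_bounds K0 x0; rewrite -/B in B0 bB Bb.
split=> //.
have b1 : 1 <= x / K%:R by rewrite ler_pdivlMr// mul1r.
have bx : x / K%:R <= x by rewrite ler_pdivrMr// ler_peMr ?(ltW x0)// ler1n.
have lnB : ln (2 + B%:R) <= l * (a^-1 * ln (4 * C0) + (2 + p%:R) / alpha).
  apply: (@le_trans _ _ (ln (4 * x))).
    (* Since [1 <= x / K], one has 2 + B < x / K + 3 <= 4 * (x / K) <= 4 * x. *)
    rewrite ler_ln ?posrE ?(pmulr_rgt0 x) ?ltr_wpDr//.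
    by move: b1 bx Bb; set b := x / _; lra.
  rewrite /x /rqmc_budget -/l -/p !mulrA.
  rewrite !lnM ?posrE ?mulr_gt0 ?powR_gt0// !ln_powR.
  rewrite -lnM ?posrE// mulrDr [(2 + _) / _]mulrDl mulrDr addrA.
  (* The three summands come from the three factors of the budget: [ln (4 * C0)] is scaled by
     [l / a >= 1], while [ln n] and [ln l] are each at most [l]. *)
  rewrite !lerD//.
  - rewrite mulrA ler_peMl ?ln_ge0// ?ler_pdivlMr ?mul1r//.
    by rewrite (le_trans C01)// ler_peMl// ?ler1n ?(ltW C00).
  - rewrite [leRHS]mulrC ler_wpM2l ?divr_ge0 ?(ltW a0)//.
    by rewrite /l ler_ln ?posrE ?addr_gt0// lerDr.
  - rewrite [leRHS]mulrC ler_wpM2l ?divr_ge0 ?(ltW a0)//.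
    by rewrite ltW// ln_sublinear.
have lnB0 : 0 <= ln (2 + B%:R) :> R.
  by rewrite ln_ge0// ler_wpDr// ler1n.
set G := a^-1 * ln (4 * C0) + (2 + p%:R) / alpha in lnB.
have HG : D * Kmax%:R `^ alpha * G ^+ p <= C0 `^ alpha.
  have /HY : Y <= 4 * C0 by rewrite (le_trans C0Y)// ler_peMl// ?(ltW C00)// ler1n.
  rewrite powRM ?(ltW C00)// -/G mulrAC [leRHS]mulrC ler_pM2r// ?powR_gt0//.
have xa : x `^ alpha = C0 `^ alpha * n%:R ^+ 2 * l ^+ p.
  rewrite /x /rqmc_budget -/l -/p !powRM ?mulr_ge0 ?powR_ge0 ?(ltW C00)//.
  by rewrite -!powRrM !divfK ?gt_eqF// !powR_mulrn ?(ltW l0).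
apply: (@le_trans _ _ ((x / K%:R) `^ alpha)); last first.
  by rewrite ge0_ler_powR ?nnegrE ?(ltW a0)// ?divr_ge0 ?(ltW x0).
rewrite powRM ?(ltW x0) ?invr_ge0 ?(ltW KR)// -powR_inv1 ?(ltW KR)//.
rewrite powRAC powR_inv1 ?powR_ge0// ler_pdivlMr ?powR_gt0// xa.
apply: (@le_trans _ _ ((D * Kmax%:R `^ alpha * G ^+ p) * (n%:R ^+ 2 * l ^+ p))).
  rewrite [leRHS](_ : _ = D * n%:R ^+ 2 * (l * G) ^+ p * Kmax%:R `^ alpha); last first.
    by rewrite exprMn; ring.
  apply: ler_pM; rewrite ?mulr_ge0 ?exprn_ge0 ?powR_ge0//.
    by rewrite ler_wpM2l ?mulr_ge0 ?exprn_ge0// lerXn2r ?nnegrE ?(le_trans lnB0).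
  by rewrite ge0_ler_powR ?nnegrE ?(ltW a0)// ler_nat.
by rewrite -[leRHS]mulrA ler_wpM2r// mulr_ge0 ?exprn_ge0 ?(ltW l0).
Qed.

Lemma measurable_block_estimate d d' (Omega : measurableType d)
    (T : measurableType d') (R : realType) (f : T -> R) (B : nat)
    (X : Omega -> B.-tuple T) :
  measurable_fun [set: T] f ->
  (forall b, measurable_fun [set: Omega] (fun w => tnth (X w) b)) ->
  measurable_fun [set: Omega] (fun w => block_estimate f (X w)).
Proof.
move=> mf mX; apply: measurable_funM => //; apply: measurable_sum => b.
exact: measurableT_comp.
Qed.

(** Indices start at [n = 1] because both budgets vanish at [n = 0]. Suprema are extended reals, so
    their finiteness is not presupposed. The map [phi n] from cube points to sample points encodes
    the RQMC representation. *)
Theorem theorem4p5 (R : realType) (dO dX : measure_display)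
    (Omega : measurableType dO) (Pr : probability Omega R)
    (X : measurableType dX) (P : nat -> probability X R)
    (Theta : Type) (O : nat -> set Theta) (L : nat -> Theta -> X -> R)
    (beta : nat -> R) (K : nat -> nat) (Ctau cbeta Cbeta : R)
    (hCtau : 0 < Ctau) (hcbeta : 0 < cbeta) (hCbeta : cbeta <= Cbeta)
    (hbeta : forall n, (0 < n)%N ->
       cbeta * n%:R <= beta n /\ beta n <= Cbeta * n%:R)
    (hK : (exists k, (0 < k)%N /\ forall n, K n = k) \/
          (exists s : seq nat, all (fun k => (2 <= k)%N) s /\
             forall n, K n \in s))
    (hO : forall n, (0 < n)%N -> O n !=set0)
    (hL : forall n theta, (0 < n)%N -> O n theta ->
       (P n).-integrable [set: X] (EFin \o L n theta)) :
  (forall (xi : forall n B : nat, 'I_(K n) -> Omega -> B.-tuple X)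
      (cl Cl : R),
    (forall n B, (0 < n)%N -> (0 < B)%N ->
       iid Pr (xi n B) /\ mc_blocks Pr (P n) (xi n B)) ->
    (forall n B theta, (0 < n)%N -> (0 < B)%N -> O n theta ->
       unbiased_blocks Pr (P n) (L n theta) (xi n B)) ->
    0 < cl -> 0 < Cl ->
    (forall n B theta, (0 < n)%N -> (0 < B)%N -> O n theta ->
       let V := 'V_Pr[averaged_estimate (L n theta) (xi n B)] in
       ((cl * (K n * B)%:R^-1)%:E <= V)%E /\
       (V <= (Cl * (K n * B)%:R^-1)%:E)%E) ->
    let sup_tau2 n B := ereal_sup
      [set tau2 Pr (beta n) (L n theta) (xi n B) | theta in O n] in
    (exists2 c0 : R, 0 < c0 &
       forall n B, (0 < n)%N -> (0 < B)%N ->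
         (sup_tau2 n B <= Ctau%:E)%E -> c0 * n%:R ^+ 2 <= (K n * B)%:R) /\
    (exists2 C1 : R, 0 < C1 &
       forall C0, C1 <= C0 -> forall n, (0 < n)%N ->
         (sup_tau2 n (block_size (K n) (mc_budget C0 n)) <= Ctau%:E)%E)) /\
  (forall (d : nat) (phi : nat -> d.-tuple R -> X)
      (u : forall n B : nat, 'I_(K n) -> Omega -> B.-tuple (d.-tuple R))
      (C alpha : R),
    let xi n B (k : 'I_(K n)) (w : Omega) : B.-tuple X :=
      map_tuple (phi n) (u n B k w) in
    (0 < d)%N ->
    (forall n, (0 < n)%N -> measurable_fun [set: d.-tuple R] (phi n)) ->
    (forall n B, (0 < n)%N -> (0 < B)%N -> rqmc_blocks Pr (u n B)) ->
    (forall n B theta, (0 < n)%N -> (0 < B)%N -> O n theta ->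
       unbiased_blocks Pr (P n) (L n theta) (@xi n B)) ->
    0 < C -> 0 < alpha ->
    (forall n B theta (k : 'I_(K n)), (0 < n)%N -> (0 < B)%N -> O n theta ->
       ('V_Pr[fun w => block_estimate (L n theta) (@xi n B k w)] <=
        (C * B%:R `^ (- alpha) * ln (2 + B%:R) ^+ d.-1)%:E)%E) ->
    let sup_tau2 n B := ereal_sup
      [set tau2 Pr (beta n) (L n theta) (@xi n B) | theta in O n] in
    exists2 C1 : R, 0 < C1 &
      forall C0, C1 <= C0 ->
        let B n := block_size (K n) (rqmc_budget alpha d C0 n) in
        (forall n, (0 < n)%N -> (sup_tau2 n (B n) <= Ctau%:E)%E) /\
        soft_bigO (fun n => (K n * B n)%:R : R)
                  (fun n => n%:R `^ (2 / alpha))).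
Proof.
have Cb0 : 0 < Cbeta by rewrite (lt_le_trans hcbeta).
(* A single bound on [K n] covers both alternatives and keeps the later constants independent of
   [n]. *)
have [Kmax KB] : exists Kmax, forall n, (0 < K n <= Kmax)%N.
  case: hK => [[k [k0 kE]]|[s [s2 sK]]].
    by exists k => n; rewrite kE k0 leqnn.
  exists (\max_(k <- s) k) => n.
  by rewrite leq_bigmax_seq// (ltn_trans _ (allP s2 _ (sK n))).
have K0 n : (0 < K n)%N by case/andP: (KB n).
have beta_sq n : (0 < n)%N ->
    cbeta ^+ 2 * n%:R ^+ 2 <= beta n ^+ 2 <= Cbeta ^+ 2 * n%:R ^+ 2.
  move=> n0; have [lo hi] := hbeta n n0.
  have cn0 : 0 <= cbeta * n%:R by rewrite mulr_ge0// ltW.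
  have b0 : 0 <= beta n by exact: le_trans lo.
  by rewrite -!exprMn !lerXn2r// ?nnegrE// mulr_ge0// ltW.
have tau2_le n th (Y : Omega -> R) (v : R) : (0 < n)%N -> O n th ->
    0 <= v -> ('V_Pr[Y] <= v%:E)%E -> Cbeta ^+ 2 * n%:R ^+ 2 * v <= Ctau ->
    ((beta n ^+ 2)%:E * 'V_Pr[Y] <= Ctau%:E)%E.
  move=> n0 Oth v0 Vv vC; have /andP[_ bhi] := beta_sq n n0.
  apply: (@le_trans _ _ ((beta n ^+ 2)%:E * v%:E)%E).
    by rewrite lee_wpmul2l// lee_fin sqr_ge0.
  by rewrite -EFinM lee_fin (le_trans _ vC)// ler_wpM2r.
split.

  (* Monte Carlo blocks: necessary and sufficient budgets *)
  move=> xi cl Cl _ _ cl0 Cl0 HV sup_tau2; split.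
    (* At any one point of the nonempty region, the lower bounds on [beta n] and on the variance
       give cbeta^2 n^2 cl / M <= Ctau, which is solved for M. *)
    exists (cl * cbeta ^+ 2 / Ctau).
      by rewrite divr_gt0// mulr_gt0// exprn_gt0.
    move=> n B n0 B0 supC; have [th Oth] := hO n n0.
    have [lo _] := HV n B th n0 B0 Oth.
    have /andP[blo _] := beta_sq n n0.
    have M0 : 0 < (K n * B)%:R :> R by rewrite ltr0n muln_gt0 K0.
    have : (((cbeta ^+ 2 * n%:R ^+ 2) * (cl * (K n * B)%:R^-1))%:E <= Ctau%:E)%E.
      apply: le_trans supC; apply: (@le_trans _ _
        (tau2 Pr (beta n) (L n th) (xi n B))); last first.
        by apply: ereal_sup_ubound; exists th.
      rewrite EFinM /tau2; apply: lee_pmul => //; rewrite lee_fin.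
        by rewrite mulr_ge0 ?sqr_ge0.
      by rewrite divr_ge0// ltW.
    rewrite lee_fin mulrA ler_pdivrMr// => H.
    by rewrite mulrAC ler_pdivrMr// [leRHS]mulrC (le_trans _ H)//; lra.
  have C10 : 0 < Cbeta ^+ 2 * Cl / Ctau by rewrite divr_gt0// mulr_gt0// exprn_gt0.
  (* This is the value of [C0] for which Cbeta^2 n^2 Cl / M equals [Ctau] at M = C0 n^2; rounding up
     only increases M. *)
  exists (Cbeta ^+ 2 * Cl / Ctau) => // C0 C0C n n0.
  have C00 : 0 < C0 by rewrite (lt_le_trans C10).
  have x0 : 0 < mc_budget C0 n by rewrite mulr_gt0// exprn_gt0// ltr0n.
  have [B0 xM _ _] := block_size_bounds (K0 n) x0.
  set B := block_size _ _ in B0 xM *.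
  have M0 : 0 < (K n * B)%:R :> R by rewrite ltr0n muln_gt0 K0.
  apply: ge_ereal_sup => _ [th Oth <-].
  have [_ hi] := HV n B th n0 B0 Oth.
  apply: (tau2_le n th _ _ n0 Oth _ hi); first by rewrite divr_ge0// ltW.
  rewrite mulrA ler_pdivrMr// (le_trans _ (ler_wpM2l (ltW hCtau) xM))//.
  rewrite /mc_budget [leRHS]mulrA [leLHS]mulrAC ler_wpM2r ?exprn_ge0//.
  by rewrite [leRHS]mulrC -ler_pdivrMr.

(* Randomized quasi-Monte Carlo blocks: sufficient budget and its order *)
move=> d phi u C alpha xi _ mphi rqmc unb C_gt0 alpha0 HV sup_tau2.
(* With this constant as [D], the inequality of [rqmc_budget_rate] says exactly that Cbeta^2 n^2
   times the assumed variance bound is at most [Ctau]. *)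
have D0 : 0 <= Cbeta ^+ 2 * C / Ctau.
  by rewrite divr_ge0 ?(ltW hCtau)// mulr_ge0 ?sqr_ge0// ltW.
have [C1 C10 rate] := rqmc_budget_rate d Kmax alpha0 D0.
exists C1 => // C0 C0C B; have C00 : 0 < C0 by rewrite (lt_le_trans C10).
split.
  move=> n n0; have [_ B0 BD] := rate C0 C0C n (K n) n0 (KB n).
  rewrite -/(B n) in B0 BD.
  have BR : 0 < (B n)%:R :> R by rewrite ltr0n.
  have lnB0 : 0 <= ln (2 + (B n)%:R) :> R.
    by rewrite ln_ge0// ler_wpDr// ler1n.
  apply: ge_ereal_sup => _ [th Oth <-].
  apply: (tau2_le n th _
    (C * (B n)%:R `^ (- alpha) * ln (2 + (B n)%:R) ^+ d.-1) n0 Oth).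
  - by rewrite !mulr_ge0 ?exprn_ge0 ?powR_ge0// ltW.
  - apply: variance_mean_le => // k.
    + apply: measurable_block_estimate => [|b].
        by have /integrableP[/measurable_EFinP] := hL n th n0 Oth.
      rewrite (_ : (fun w => _) = phi n \o (fun w => tnth (u n (B n) k w) b));
        last by apply/funext => w /=; rewrite tnth_map.
      apply: measurableT_comp; first exact: mphi.
      have [[mu _ _] _] := rqmc n (B n) n0 B0.
      by have /measurable_fun_tnthP := mu k; apply.
    (* Unbiasedness equates the expectation with a real number, hence it is finite. *)
    + by rewrite unb.
    + exact: HV.
  - rewrite powRN -(@ler_pM2l _ Ctau^-1) ?invr_gt0// mulVf ?gt_eqF//.
    rewrite [leLHS](_ : _ = Cbeta ^+ 2 * C / Ctau * n%:R ^+ 2 *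
      ln (2 + (B n)%:R) ^+ d.-1 / (B n)%:R `^ alpha); last by ring.
    by rewrite ler_pdivrMr ?powR_gt0// mul1r.
(* [soft_bigO] asks for a natural power of the logarithm, so the real exponent (d - 1) / alpha is
   rounded up. *)
pose r := Num.bound (d.-1%:R / alpha).
have rP : d.-1%:R / alpha <= r%:R by rewrite ltW// archi_boundP// divr_ge0// ltW.
(* The factor 2 is the cost of rounding: K B < x + K <= 2 x for the budget x. *)
exists r; apply/eqO_exP; exists (2 * C0); first by rewrite mulr_gt0.
(* From n >= e on, the logarithm is at least 1, so enlarging its exponent to [r] enlarges the
   bound. *)
exists (maxn 1 (Num.bound (expR 1 : R))) => // n /=; rewrite geq_max => /andP[n0 ne].
have [xK B0 _] := rate C0 C0C n (K n) n0 (KB n).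
have x0 := rqmc_budget_gt0 alpha d C00 n0.
have [_ _ _ Bx] := block_size_bounds (K0 n) x0.
have KR : 0 < (K n)%:R :> R by rewrite ltr0n.
have l1 : 1 <= ln (2 + n%:R) :> R.
  rewrite -[leLHS]expRK ler_ln ?posrE ?expR_gt0 ?addr_gt0 ?ltr0n//.
  by rewrite ler_wpDl// ltW// (lt_le_trans (archi_boundP (expR_ge0 _)))// ler_nat.
rewrite !ger0_norm ?mulr_ge0 ?powR_ge0 ?exprn_ge0 ?(le_trans _ l1)//.
apply: (@le_trans _ _ (2 * rqmc_budget alpha d C0 n)).
  rewrite natrM (le_trans (ler_wpM2l (ltW KR) (ltW Bx)))//.
  by rewrite mulrDr mulr1 mulrC divfK ?gt_eqF// mulr_natl lerD2l.
rewrite /rqmc_budget -!mulrA !ler_pM2l// ?powR_gt0 ?ltr0n//.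
by rewrite -powR_mulrn ?(le_trans _ l1)// ler_powR.
Qed.
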